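(* Let $d=2^r$ for some positive integer $r$. Let $\mathcal{T}=(T^i)_{i=1}^d$ be the family of subsets of $\{1,\dots,2d\}$ given by $T^i=\{2i-3,2i-2,2i-1,2i\}$, where the indices $-1$ and $0$ are identified with $2d-1$ and $2d$, respectively (so $T^1=\{2d-1,2d,1,2\}$). Let $H^{\mathrm{zz}}_d=(h^i)_{i=1}^d$ be the zig-zag encoding, and set $h^{d+1}:=h^1$. Then $(\lambda,z)\in Q(\mathcal{T},H^{\mathrm{zz}}_d)$ if and only if all of the following hold: $$\sum_{i=1}^d\min\{h^i_k,h^{i+1}_k\}(\lambda_{2i-1}+\lambda_{2i})\le z_k\qquad\text{for all }k\in\{1,\dots,r\},$$ $$\sum_{i=1}^d\max\{h^i_k,h^{i+1}_k\}(\lambda_{2i-1}+\lambda_{2i})\ge z_k\qquad\text{for all }k\in\{1,\dots,r\},$$ $$\sum_{i=1}^d\min\left\{\frac{h^i_k}{2^\ell}-\frac{h^i_\ell}{2^k},\ \frac{h^{i+1}_k}{2^\ell}-\frac{h^{i+1}_\ell}{2^k}\right\}(\lambda_{2i-1}+\lambda_{2i})\le\frac{z_k}{2^\ell}-\frac{z_\ell}{2^k}\qquad\text{for all }\{k,\ell\}\in[r]^2,$$ $$\sum_{i=1}^d\max\left\{\frac{h^i_k}{2^\ell}-\frac{h^i_\ell}{2^k},\ \frac{h^{i+1}_k}{2^\ell}-\frac{h^{i+1}_\ell}{2^k}\right\}(\lambda_{2i-1}+\lambda_{2i})\ge\frac{z_k}{2^\ell}-\frac{z_\ell}{2^k}\qquad\text{for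 all }\{k,\ell\}\in[r]^2,$$ $$(\lambda,z)\in\Delta^{2d}\times\mathbb{R}^r.$$
   Context: $[r]^2=\{\{k,\ell\}: k,\ell\in\{1,\dots,r\},\ k\ne\ell\}$ is the set of unordered pairs of distinct indices (the pair of inequalities attached to $\{k,\ell\}$ does not depend on the order in which $k,\ell$ are taken). $\Delta^N=\{\lambda\in\mathbb{R}^N_{\ge0}:\sum_v\lambda_v=1\}$. For $T\subseteq\{1,\dots,N\}$, $P(T)=\{\lambda\in\Delta^N:\lambda_v\ne0\text{ only if }v\in T\}$. For a family $\mathcal{T}=(T^i)_{i=1}^d$ of subsets of $\{1,\dots,N\}$ and pairwise distinct vectors $H=(h^i)_{i=1}^d$ in $\mathbb{R}^r$, $Q(\mathcal{T},H)=\operatorname{Conv}\big(\bigcup_{i=1}^d(P(T^i)\times\{h^i\})\big)\subseteq\mathbb{R}^N\times\mathbb{R}^r$. $h^i_k$ is the $k$-th component of $h^i$. Zig-zag encoding: define $C^s\in\mathbb{Z}^{2^s\times s}$ recursively by $C^1=(0,1)^T$ and $$C^{s+1}=\begin{pmatrix}C^s&\mathbf{0}\\ C^s+\mathbf{1}\otimes C^s_{2^s}&\mathbf{1}\end{pmatrix},$$ where $\mathbf{0},\mathbf{1}$ are the all-zeros and all-ones column vectors of length $2^s$, $C^s_{2^s}$ is the last row of $C^s$, and $u\otimes v=uv^T$ (so the last row of $C^s$ is added to every row of $C^s$). For $d=2^r$, $H^{\mathrm{zz}}_d=(h^i)_{i=1}^d$ where $h^i$ is the $i$-th row of $C^r$.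 (The family $\mathcal{T}$ encodes the relaxation of the annulus in the plane by a cyclic ring of $d$ quadrilaterals with $2d$ vertices in total, consecutive quadrilaterals sharing two vertices.) *)

(* Defs.v *)
From HB Require Import structures.
From mathcomp Require Export all_boot all_order all_algebra.
From mathcomp Require Export classical_sets reals convex.
Set Implicit Arguments.
Unset Strict Implicit.
Unset Printing Implicit Defensive.
Import Order.TTheory GRing.Theory Num.Theory.
Local Open Scope classical_set_scope.
Local Open Scope ring_scope.

Definition conv_hull (R : realType) (V : lmodType R) (A : set V) : set V :=
  smallest (@convex_set R V) A.

Definition simplex (R : realType) (N : nat) : set 'rV[R]_N :=
  [set lam | (forall v, 0 <= lam 0 v) /\ \sum_v lam 0 v = 1].

Definition face (R : realType) (N : nat) (T : {set 'I_N}) : set 'rV[R]_N :=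
  [set lam | simplex lam /\ forall v, lam 0 v != 0 -> v \in T].

Definition embedding (R : realType) (N d r : nat)
    (T : 'I_d -> {set 'I_N}) (h : 'I_d -> 'rV[R]_r) :
    set ('rV[R]_N * 'rV[R]_r)%type :=
  conv_hull (\bigcup_(i in [set: 'I_d]) (face (T i) `*` [set h i])).

Fact zigzag_rows s : (2 ^ s + 2 ^ s = 2 ^ s.+1)%N.
Proof. by rewrite expnS mul2n addnn. Qed.

Fact zigzag_last_subproof s : ((2 ^ s).-1 < 2 ^ s)%N.
Proof. by rewrite prednK ?expn_gt0. Qed.

Definition zigzag_last s : 'I_(2 ^ s) := Ordinal (zigzag_last_subproof s).

(* The recursion starts from the empty 1 x 0 matrix, so that the first step    *)
(* produces (0, 1)^T (zigzag1); castmx only identifies 2 ^ s + 2 ^ s with      *)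
(* 2 ^ s.+1 and s + 1 with s.+1.                                               *)
Fixpoint zigzag (s : nat) : 'M[int]_(2 ^ s, s) :=
  if s is s'.+1 then
    castmx (zigzag_rows s', addn1 s')
      (block_mx
         (zigzag s')                                              (const_mx 0)
         (zigzag s' + const_mx 1 *m row (zigzag_last s') (zigzag s'))
                                                                  (const_mx 1))
  else 0.

Fact zigzag1 : zigzag 1 = \matrix_(i < 2 ^ 1, j < 1) (i : nat)%:Z.
Proof.
apply/matrixP => -[[|[|//]] lti] j; rewrite castmxE [RHS]mxE /=;
  have -> : cast_ord (esym (addn1 0)) j = rshift 0 ord0
    by apply: val_inj; case: j => -[].
- have -> : cast_ord (esym (zigzag_rows 0)) (Ordinal lti) = lshift 1 ord0
    by apply: val_inj.
  by rewrite block_mxEur mxE.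
- have -> : cast_ord (esym (zigzag_rows 0)) (Ordinal lti) = rshift 1 ord0
    by apply: val_inj.
  by rewrite block_mxEdr mxE.
Qed.

(* 'I_d is 0-based, so zz_code i is the row of index i + 1 of zigzag r.        *)
Definition zz_code (R : realType) (r : nat) (i : 'I_(2 ^ r)) : 'rV[R]_r :=
  map_mx intr (row i (zigzag r)).

Fact vtx_subproof d (b : bool) (i : 'I_d) : (i.*2 + b < 2 * d)%N.
Proof.
by rewrite mul2n; case: b; rewrite ?addn1 ?addn0 ?ltn_Sdouble ?ltn_double.
Qed.

(* If i stands for the 1-based index i' = i + 1, then vtx_odd i and vtx_even i *)
(* stand for the 1-based vertices 2i' - 1 and 2i'.                             *)
Definition vtx_odd d (i : 'I_d) : 'I_(2 * d) := Ordinal (vtx_subproof false i).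
Definition vtx_even d (i : 'I_d) : 'I_(2 * d) := Ordinal (vtx_subproof true i).

(* ord_pred is the cyclic predecessor: the 1-based vertices 2i' - 3, 2i' - 2   *)
(* are those attached to i' - 1, with i' = 1 wrapping around to d.             *)
Definition annulus d (i : 'I_d) : {set 'I_(2 * d)} :=
  [set vtx_odd (ord_pred i); vtx_even (ord_pred i); vtx_odd i; vtx_even i].

(* Main.v *)
Require Import Defs.
From mathcomp Require Import interval_inference lra ring zify.
Set Implicit Arguments.
Unset Strict Implicit.
Unset Printing Implicit Defensive.
Import Order.TTheory GRing.Theory Num.Theory.
Local Open Scope ring_scope.

(** Both vertices 2i - 1 and 2i lie on the edge shared by the quadrilaterals i
    and i + 1, so a convex combination of the generators may distribute the
    weight w_i = lambda_(2i-1) + lambda_(2i) freely between the codes h^i and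
    h^(i+1).  Hence (lambda, z) belongs to Q exactly when lambda is in the
    simplex and z is in the zonotope, the sum over i of the segments
    w_i [h^i, h^(i+1)] ([annulus_embeddingP]).  The four families of
    inequalities hold on this zonotope because a linear form on a segment lies
    between its values at the two ends ([sum_segment_bounds]).

    For the converse, the zig-zag code moves by a unit vector at each step,
    except for the closing step from the last row back to the first, which is
    the opposite of v = (2^r / 2^k)_k for k = 1, ..., r ([zz_code_step],
    [zz_code_wrap]).  Segments along the coordinate axes add up to a box, so
    the zonotope is a box with lower corner at the sum of the w_i h^i, swept
    along the single direction - v: z belongs to it as soon as z + t v is in
    the box for some t with 0 <= t <= w_d.  Each
    coordinate of the box confines t to an interval, and intervals of the line
    have a common point once any two of them meet ([line_helly]).  The
    intervals of coordinate k and [0, w_d] meet by the inequalities on z_k;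
    those of coordinates k and l meet by the inequalities on
    z_k / 2^l - z_l / 2^k, a linear form that vanishes on v
    ([unit_segments_and_one]). *)

(** * Convex sets *)

Lemma convex_setP (R : realType) (V : lmodType R) (A : set V) :
  @convex_set R V A <->
  forall t x y, 0 <= t <= 1 -> A x -> A y -> A (t *: x + (1 - t) *: y).
Proof.
split=> [cA t x y /andP[t_ge0 t_le1] /mem_set Ax /mem_set Ay | cA x y t].
  exact: set_mem (cA x y (Itv01 t_ge0 t_le1) Ax Ay).
move=> /set_mem Ax /set_mem Ay; apply/mem_set/cA => //.
by apply/andP; split.
Qed.

Lemma convex_conv_hull (R : realType) (V : lmodType R) (A : set V) :
  @convex_set R V (conv_hull A).
Proof.
apply/convex_setP => t x y t01 Ax Ay B [/[dup] cB /convex_setP cB' AB].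
by apply: cB' => //; [apply: Ax | apply: Ay].
Qed.

(** The weights of a partial sum do not add up to 1, so the induction carries
    the unnormalized form: every partial sum is its total weight times a point
    of the set. *)
Lemma convex_set_sum (R : realType) (V : lmodType R) (A : set V)
    (I : finType) (a : I -> R) (p : I -> V) :
  @convex_set R V A -> (forall i, 0 <= a i) -> \sum_i a i = 1 ->
  (forall i, A (p i)) -> A (\sum_i a i *: p i).
Proof.
move=> /convex_setP cA a_ge0 a_sum Ap.
have [i0 _] : {i0 : I | true}.
  case: (pickP (@predT I)) => [i0 _ | no_i]; first by exists i0.
  by move/eqP: a_sum; rewrite big_pred0 // eq_sym oner_eq0.
pose K (x : V) (s : R) := 0 <= s /\ exists2 q, A q & x = s *: q.
suff [_ [q Aq ->]] : K (\sum_i a i *: p i) (\sum_i a i).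
  by rewrite a_sum scale1r.
apply: (big_ind2 K) => [| x s x' s' | i _].
- by split=> //; exists (p i0); rewrite ?scale0r.
- move=> [s_ge0 [q Aq ->]] [s'_ge0 [q' Aq' ->]]; split; first exact: addr_ge0.
  have [s0|s_neq0] := eqVneq (s + s') 0.
    exists q => //; have /andP[/eqP-> /eqP->] : (s == 0) && (s' == 0).
      by rewrite -paddr_eq0 ?s0.
    by rewrite addr0 !scale0r addr0.
  have s_gt0 : 0 < s + s' by rewrite lt0r s_neq0 addr_ge0.
  exists (s / (s + s') *: q + (1 - s / (s + s')) *: q').
    apply: cA => //; rewrite divr_ge0 ?(ltW s_gt0) //=.
    by rewrite ler_pdivrMr // mul1r lerDl.
  by rewrite scalerDr !scalerA; congr (_ *: _ + _ *: _); field.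
- by split=> //; exists (p i).
Qed.

(** * Vertices of the annulus *)

Section AnnulusVertices.

Variable d : nat.
Implicit Types (i : 'I_d) (v : 'I_(2 * d)).

Fact edge_subproof v : (v./2 < d)%N.
Proof. by rewrite ltn_half_double -mul2n. Qed.

(** Vertices are numbered in pairs; a pair spans the edge common to the
    quadrilaterals [edge v] and [ordS (edge v)]. *)
Definition edge v : 'I_d := Ordinal (edge_subproof v).

Lemma edge_odd i : edge (vtx_odd i) = i.
Proof. by apply: val_inj; rewrite /= addn0 doubleK. Qed.

Lemma edge_even i : edge (vtx_even i) = i.
Proof. by apply: val_inj; rewrite /= addn1 /= uphalf_double. Qed.

Lemma vtxP v : v = vtx_odd (edge v) \/ v = vtx_even (edge v).
Proof.
have := odd_double_half v; case: (odd v) => /= vE; [right | left];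
  by apply: val_inj; rewrite /= -[LHS]vE addnC.
Qed.

Lemma mem_annulus i v :
  (v \in annulus i) = (edge v == ord_pred i) || (edge v == i).
Proof.
rewrite !inE; apply/idP/idP.
  move=> /orP[/orP[/orP[]|]|] /eqP->;
    by rewrite ?edge_odd ?edge_even eqxx ?orbT.
by case: (vtxP v) => vE /orP[] /eqP eE; rewrite vE eE eqxx ?orbT.
Qed.

Lemma sum_vtx (V : nmodType) (F : 'I_(2 * d) -> V) :
  \sum_v F v = \sum_i (F (vtx_odd i) + F (vtx_even i)).
Proof.
rewrite (partition_big edge predT) //=; apply: eq_bigr => i _.
rewrite (bigD1 (vtx_odd i)) ?edge_odd //=; congr (_ + _).
rewrite (big_pred1 (vtx_even i)) // => v /=.
apply/idP/eqP => [/andP[/eqP eE] | ->].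
  by case: (vtxP v) => vE; rewrite vE eE // eqxx.
by rewrite edge_even eqxx -val_eqE /= addn0 addn1 neq_ltn ltnSn orbT.
Qed.

End AnnulusVertices.

(** * The embedding as a zonotope *)

(** When w = 0 the quotient takes the value 0, which is the right ratio since y
    vanishes too. *)
Lemma ratio01 (R : realFieldType) (y w : R) :
  0 <= y <= w -> 0 <= y / w <= 1 /\ y / w * w = y.
Proof.
move=> /andP[y_ge0 y_le]; have [w0|w_neq0] := eqVneq w 0.
  have /eqP-> : y == 0 by rewrite eq_le y_ge0 -w0 y_le.
  by rewrite !mul0r lexx ler01.
have w_gt0 : 0 < w by rewrite lt0r w_neq0 (le_trans y_ge0).
by rewrite divfK // divr_ge0 ?(ltW w_gt0) // ler_pdivrMr ?mul1r.
Qed.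

Definition edge_weight (R : realType) d (lam : 'rV[R]_(2 * d)) (i : 'I_d) : R :=
  lam 0 (vtx_odd i) + lam 0 (vtx_even i).

(** [y i] is the part of the weight of edge [i] that is carried by the code of
    the quadrilateral following the edge. *)
Lemma annulus_embeddingP (R : realType) (d r : nat) (h : 'I_d -> 'rV[R]_r)
    (lam : 'rV[R]_(2 * d)) (z : 'rV[R]_r) :
  embedding (@annulus d) h (lam, z) <->
  simplex lam /\
  exists2 y : 'I_d -> R, (forall i, 0 <= y i <= edge_weight lam i) &
    z = \sum_i (edge_weight lam i *: h i + y i *: (h (ordS i) - h i)).
Proof.
split.
  pose A : set ('rV[R]_(2 * d) * 'rV[R]_r) := ([set p | simplex p.1 /\
    exists2 y : 'I_d -> R, (forall i, 0 <= y i <= edge_weight p.1 i) &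
    p.2 = \sum_i (edge_weight p.1 i *: h i
                  + y i *: (h (ordS i) - h i))])%classic.
  suff sub : (embedding (@annulus d) h `<=` A)%classic by move/sub.
  apply: smallest_sub.
    apply/convex_setP => t [la za] [lb zb] t01.
    move=> [[la_ge0 la_sum] [ya ya_w /= zaE]].
    move=> [[lb_ge0 lb_sum] [yb yb_w /= zbE]].
    have /andP[t_ge0 t_le1] := t01.
    have t'_ge0 : 0 <= 1 - t by rewrite subr_ge0.
    split=> /=.
      split=> [v|]; first by rewrite !mxE addr_ge0 // mulr_ge0.
      under eq_bigr do rewrite !mxE.
      by rewrite big_split /= -!mulr_sumr la_sum lb_sum !mulr1 addrC subrK.
    exists (fun i => t * ya i + (1 - t) * yb i) => [i|].
      have /andP[ya_ge0 ya_le] := ya_w i; have /andP[yb_ge0 yb_le] := yb_w i.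
      rewrite addr_ge0 ?mulr_ge0 //= /edge_weight !mxE addrACA -!mulrDr.
      by rewrite lerD ?ler_wpM2l.
    rewrite zaE zbE !scaler_sumr -big_split; apply: eq_bigr => i _ /=.
    apply/rowP => k; rewrite /edge_weight !mxE; ring.
  move=> [l _] [i _ [/= [[l_ge0 l_sum] l_face] ->]]; split=> //=.
  have w_ge0 j : 0 <= edge_weight l j by rewrite addr_ge0.
  have w_face j : edge_weight l j = 0 \/ j = ord_pred i \/ j = i.
    have [/orP[]/eqP-> | j_far] := boolP ((j == ord_pred i) || (j == i)).
    - by right; left.
    - by right; right.
    have l0 v : edge v = j -> l 0 v = 0.
      move=> vj; apply/eqP; apply: contraNT j_far => /l_face.
      by rewrite mem_annulus vj.
    by left; rewrite /edge_weight !l0 ?edge_odd ?edge_even ?addr0.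
  (* Quadrilateral i comes after the edge ord_pred i but before the edge i. *)
  exists (fun j => if j == ord_pred i then edge_weight l j else 0) => [j|].
    by case: ifP => _; rewrite lexx w_ge0.
  transitivity (\sum_j edge_weight l j *: h i).
    by rewrite -scaler_suml -sum_vtx l_sum scale1r.
  apply: eq_bigr => j _; case: eqP => [->|j_pred].
    by rewrite ord_predK -scalerDr addrC subrK.
  by rewrite scale0r addr0; case: (w_face j) => [->|[] // ->]; rewrite ?scale0r.
move=> [[lam_ge0 lam_sum] [y y_w zE]].
set w := edge_weight lam in y_w zE.
pose t i := y i / w i.
have t01 i : 0 <= t i <= 1 := (ratio01 (y_w i)).1.
have tw i : w i * t i = y i by rewrite mulrC (ratio01 (y_w i)).2.
pose q i := t i *: h (ordS i) + (1 - t i) *: h i.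
(* One point of the hull over each vertex, at the ratio of its edge. *)
have -> : (lam, z) = \sum_v lam 0 v *: (delta_mx 0 v, q (edge v)).
  rewrite [RHS]surjective_pairing; congr (_, _).
    by rewrite raddf_sum; apply: row_sum_delta.
  rewrite raddf_sum /= sum_vtx zE; apply: eq_bigr => i _.
  rewrite edge_odd edge_even -scalerDl -/(edge_weight lam i) -/(w i) -tw.
  by apply/rowP => k; rewrite !mxE; ring.
apply: convex_set_sum => // [|v]; first exact: convex_conv_hull.
have -> : (delta_mx 0 v, q (edge v)) =
  t (edge v) *: (delta_mx 0 v : 'rV[R]_(2 * d), h (ordS (edge v)))
  + (1 - t (edge v)) *: (delta_mx 0 v, h (edge v)).
  by congr (_, _); rewrite /= -scalerDl addrC subrK scale1r.
have gen i : v \in annulus i -> embedding (@annulus d) h (delta_mx 0 v, h i).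
  move=> vi; apply: sub_gen_smallest; exists i => //; split=> //=.
  split; first split.
  - by move=> u; rewrite mxE ler0n.
  - rewrite (bigD1 v) //= big1 ?mxE ?eqxx ?addr0 // => u /negPf uv.
    by rewrite mxE uv.
  - by move=> u; rewrite mxE; case: (eqVneq u v) => [->|]; rewrite ?eqxx.
have /convex_setP cvxE : @convex_set R _ (embedding (@annulus d) h).
  exact: convex_conv_hull.
apply: cvxE => //; apply: gen.
  by rewrite mem_annulus ordSK eqxx.
by rewrite mem_annulus eqxx orbT.
Qed.

(** * Sums of segments *)

(** Helly's theorem on the line for the intervals [a k, b k] and [0, T]: the
    largest left end is a common point. *)
Lemma line_helly (R : realDomainType) (n : nat) (T : R) (a b : 'I_n -> R) :
  0 <= T -> (forall k, a k <= T) -> (forall k, 0 <= b k) ->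
  (forall k l, a k <= b l) ->
  exists2 t, 0 <= t <= T & forall k, a k <= t <= b k.
Proof.
move=> T_ge0 aT b_ge0 ab; exists (\big[Num.max/0]_k a k).
  by rewrite bigmax_ge_id bigmax_le.
by move=> k; rewrite le_bigmax /= bigmax_le.
Qed.

(** Coordinate k confines t to an interval with ends - x k / v k and
    (W k - x k) / v k.  The inequality for k and l puts the left end of k below
    the right end of l, cleared of denominators; for k = l this is 0 <= W k.
    The other two inequalities compare these intervals with [0, T]. *)
Lemma box_segment_sum (R : realFieldType) (n : nat) (T : R)
    (v W x : 'I_n -> R) :
  0 <= T -> (forall k, 0 < v k) -> (forall k, 0 <= W k) ->
  (forall k, - (T * v k) <= x k) -> (forall k, x k <= W k) ->
  (forall k l, k != l -> - (W l * v k) <= x k * v l - x l * v k) ->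
  exists2 t, 0 <= t <= T & forall k, 0 <= x k + t * v k <= W k.
Proof.
move=> T_ge0 v_gt0 W_ge0 xlo xhi xpair.
have [|k|k|k l|t tT tk] :=
    @line_helly R n T (fun k => - x k / v k) (fun k => (W k - x k) / v k).
- exact: T_ge0.
- by rewrite ler_pdivrMr // lerNl.
- by rewrite divr_ge0 ?subr_ge0 // ltW.
- rewrite ler_pdivrMr // mulrAC ler_pdivlMr //.
  have [<-|/xpair] := eqVneq k l; last by rewrite mulrBl; lra.
  by rewrite ler_wpM2r ?(ltW (v_gt0 k)) // lerDr.
exists t => // k; have := tk k.
by rewrite ler_pdivrMr // ler_pdivlMr // => /andP[]; lra.
Qed.

Lemma sum_segment_bounds (R : realDomainType) (I : finType) (a b w y : I -> R) :
  (forall i, 0 <= y i <= w i) ->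
  \sum_i Num.min (a i) (b i) * w i <= \sum_i (w i * a i + y i * (b i - a i))
    <= \sum_i Num.max (a i) (b i) * w i.
Proof.
move=> y_w; apply/andP; split; apply: ler_sum => i _;
  have /andP[y_ge0 y_le] := y_w i; case: (leP (a i) (b i)) => ab; nra.
Qed.

Lemma sum_min_shift (R : realDomainType) (I : finType) (a b w : I -> R) :
  \sum_i Num.min (a i) (b i) * w i =
  \sum_i w i * a i + \sum_i Num.min 0 (b i - a i) * w i.
Proof.
rewrite -big_split; apply: eq_bigr => i _ /=.
by rewrite [w i * _]mulrC -mulrDl addr_minr addr0 addrC subrK.
Qed.

Lemma sum_max_shift (R : realDomainType) (I : finType) (a b w : I -> R) :
  \sum_i Num.max (a i) (b i) * w i =
  \sum_i w i * a i + \sum_i Num.max 0 (b i - a i) * w i.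
Proof.
rewrite -big_split; apply: eq_bigr => i _ /=.
by rewrite [w i * _]mulrC -mulrDl addr_maxr addr0 addrC subrK.
Qed.

(** The unit directions sum to a box with sides [W k], the total weight of the
    segments along axis k, and the segment [i0] sweeps this box along - v.  The
    form [f k l] vanishes on v, so its minimum on the zonotope differs from its
    value at the sum of the w_i a_i only by the contribution of the segments
    along axis l, where it decreases at rate v k: this is the overlap condition
    of [box_segment_sum]. *)
Lemma unit_segments_and_one (R : realFieldType) (I : finType) (r : nat)
    (a b : I -> 'rV[R]_r) (i0 : I) (kap : I -> 'I_r) (v : 'I_r -> R)
    (w : I -> R) (z : 'rV[R]_r)
    (f := fun (u : 'rV[R]_r) k l => u 0 k * v l - u 0 l * v k) :
  (forall i, 0 <= w i) -> (forall k, 0 < v k) ->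
  (forall i, i != i0 -> forall k, b i 0 k - a i 0 k = (kap i == k)%:R) ->
  (forall k, b i0 0 k - a i0 0 k = - v k) ->
  (forall k, \sum_i Num.min (a i 0 k) (b i 0 k) * w i <= z 0 k) ->
  (forall k, z 0 k <= \sum_i Num.max (a i 0 k) (b i 0 k) * w i) ->
  (forall k l, k != l ->
     \sum_i Num.min (f (a i) k l) (f (b i) k l) * w i <= f z k l) ->
  exists2 y, (forall i, 0 <= y i <= w i) &
    z = \sum_i (w i *: a i + y i *: (b i - a i)).
Proof.
move=> w_ge0 v_gt0 unitE skewE zlo zhi zpair.
pose W k := \sum_(i | i != i0) (kap i == k)%:R * w i.
pose x k := z 0 k - \sum_i w i * a i 0 k.
have fB i k l : f (b i) k l - f (a i) k l =
    (b i 0 k - a i 0 k) * v l - (b i 0 l - a i 0 l) * v k.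
  by rewrite /f; ring.
have [//|//|k|k|k|k l kl|t tT tk] := @box_segment_sum R r (w i0) v W x.
- by apply: sumr_ge0 => i _; rewrite mulr_ge0.
- have := zlo k; rewrite sum_min_shift [X in _ + X](bigD1 i0) //= skewE.
  rewrite min_r ?oppr_le0 ?(ltW (v_gt0 k)) // [X in _ + (_ + X)]big1.
    by rewrite /x addr0 mulNr mulrC; lra.
  by move=> i /unitE->; rewrite min_l // mul0r.
- have := zhi k; rewrite sum_max_shift [X in _ + X](bigD1 i0) //= skewE.
  rewrite max_l ?oppr_le0 ?(ltW (v_gt0 k)) // mul0r add0r.
  rewrite [X in _ + X](_ : _ = W k); first by rewrite /x; lra.
  by apply: eq_bigr => i /unitE->; rewrite max_r.
- have := zpair k l kl; rewrite sum_min_shift [X in _ + X](bigD1 i0) //=.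
  rewrite fB !skewE !mulNr opprK [v l * v k]mulrC addNr minxx mul0r add0r.
  rewrite [X in _ + X](_ : _ = - (W l * v k)).
    have -> : \sum_i w i * f (a i) k l =
        (\sum_i w i * a i 0 k) * v l - (\sum_i w i * a i 0 l) * v k.
      by rewrite !mulr_suml -sumrB; apply: eq_bigr => i _; rewrite /f; ring.
    by rewrite /x /f; lra.
  rewrite mulr_suml -sumrN; apply: eq_bigr => i i_i0; rewrite fB !unitE //.
  have [->|_] := eqVneq (kap i) l.
    rewrite eq_sym (negPf kl) mul0r sub0r !mul1r min_r ?oppr_le0 ?ltW //.
    by rewrite mulNr mulrC.
  rewrite !mul0r subr0 min_l ?mul0r ?oppr0 //.
  by rewrite mulr_ge0 // ltW.
pose u k := (x k + t * v k) / W k.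
have u01 k : 0 <= u k <= 1 := (ratio01 (tk k)).1.
have uW k : u k * W k = x k + t * v k := (ratio01 (tk k)).2.
(* All segments along axis k are cut at the same ratio u k. *)
exists (fun i => if i == i0 then t else u (kap i) * w i) => [i|].
  case: eqP => [->|_] //; have /andP[u_ge0 u_le1] := u01 (kap i).
  by rewrite mulr_ge0 //= ler_piMl.
apply/rowP => k; rewrite summxE.
under eq_bigr do rewrite !mxE.
rewrite big_split /= [X in _ + X](bigD1 i0) //= eqxx skewE.
rewrite [X in _ + (_ + X)](_ : _ = u k * W k); first by rewrite uW /x; ring.
rewrite mulr_sumr; apply: eq_bigr => i i_i0; rewrite (negPf i_i0) unitE //.
by have [->|_] := eqVneq (kap i) k; rewrite ?mul1r ?mul0r ?mulr1 ?mulr0.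
Qed.

(** * Steps of the zig-zag code *)

Lemma flips_last s k : (k < s)%N ->
  (((2 ^ s).-1 + 2 ^ k) %/ 2 ^ k.+1 = 2 ^ (s - k.+1))%N.
Proof.
move=> lt_ks.
have -> : (2 ^ s = 2 ^ (s - k.+1) * 2 ^ k.+1)%N by rewrite -expnD subnK.
set a := (2 ^ (s - _))%N; have a_gt0 : (0 < a)%N by rewrite expn_gt0.
have m_gt0 : (0 < 2 ^ k)%N by rewrite expn_gt0.
have -> : ((a * 2 ^ k.+1).-1 + 2 ^ k = a * 2 ^ k.+1 + (2 ^ k).-1)%N.
  by rewrite expnS; nia.
by rewrite divnMDl ?expn_gt0 // divn_small ?addn0 // expnS; lia.
Qed.

(** With [i] and [k] counted from 0, this is the number of integers in [1, i]
    congruent to 2^k modulo 2^(k+1): column k counts the flips of bit k in the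
    binary reflected Gray code.  The recursion agrees with this formula because
    it adds, for a shift of the row by 2^s, the entry 2^(s-k-1) of the last row,
    which is the number of periods 2^(k+1) in 2^s. *)
Lemma zigzagE s (i : 'I_(2 ^ s)) (k : 'I_s) :
  zigzag s i k = ((i + 2 ^ k) %/ 2 ^ k.+1)%:Z.
Proof.
elim: s i k => [|s IHs] i k; first by case: k.
rewrite /= castmxE /block_mx !mxE.
case: splitP => i' /= iE; rewrite ?mxE; case: splitP => k' /= kE;
  rewrite ?mxE ?big_ord1 ?mxE ?mul1r ?IHs iE kE //=.
- by rewrite ord1 addn0 divn_small // expnS mul2n -addnn ltn_add2r.
- rewrite -PoszD flips_last //; congr Posz.
  have {2}<- : (2 ^ (s - k'.+1) * 2 ^ k'.+1 = 2 ^ s)%N by rewrite -expnD subnK.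
  by rewrite -addnA divnMDl ?expn_gt0 // addnC.
- rewrite ord1 addn0 addnAC addnn -mul2n -expnS -{1}[(2 ^ s.+1)%N]mul1n.
  by rewrite divnMDl ?expn_gt0 // divn_small // expnS mul2n -addnn ltn_addr.
Qed.

(** Column k increases from row i to row i + 1 exactly when 2^(k+1) divides
    i + 1 + 2^k, that is, when k is the 2-adic valuation of i + 1; so exactly
    one column increases. *)
Lemma zigzag_step s (i j : 'I_(2 ^ s)) : j = i.+1 :> nat ->
  exists k0 : 'I_s, forall k, zigzag s j k = zigzag s i k + (k0 == k)%:Z.
Proof.
move=> jE; have lt_k0 : (logn 2 i.+1 < s)%N.
  rewrite -(ltn_exp2l _ _ (isT : 1 < 2)%N).
  apply: leq_ltn_trans (ltn_ord j); rewrite jE.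
  by rewrite dvdn_leq // pfactor_dvdnn.
exists (Ordinal lt_k0) => k; rewrite !zigzagE jE addSn divnS ?expn_gt0 //.
rewrite addnC PoszD; congr (_ + Posz (nat_of_bool _)).
rewrite -val_eqE /= -addSn.
apply/idP/eqP => [dvd_k | <-]; last first.
  have [q odd_q iE] := pfactor_coprime (isT : prime 2) (ltn0Sn i).
  rewrite [X in (X + _)%N]iE -mulSnr expnS dvdn_pmul2r ?expn_gt0 // dvdn2 /=.
  by rewrite negbK -coprime2n.
apply/eqP; rewrite eqn_leq; apply/andP; split.
  rewrite leqNgt; apply/negP => lt_kk0.
  move: dvd_k; rewrite dvdn_addr; last by rewrite pfactor_dvdn.
  by rewrite dvdn_Pexp2l // ltnn.
rewrite -pfactor_dvdn //.
rewrite -(dvdn_addl _ (dvdnn (2 ^ k))).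
by apply: dvdn_trans dvd_k; rewrite dvdn_exp2l.
Qed.

Section Code.
Variables (R : realType) (r : nat).
Local Notation h := (@zz_code R r).

Lemma zz_code_step (i : 'I_(2 ^ r)) : i != zigzag_last r ->
  exists k0 : 'I_r, forall k, h (ordS i) 0 k - h i 0 k = (k0 == k)%:R.
Proof.
rewrite -val_eqE /= => i_last.
have lt_i1 : (i.+1 < 2 ^ r)%N.
  by have := ltn_ord i; move: i_last; lia.
have [|k0 stepE] := @zigzag_step r i (ordS i); first by rewrite /= modn_small.
by exists k0 => k; rewrite !mxE stepE intrD addrC addKr.
Qed.

Lemma zz_code_wrap k :
  h (ordS (zigzag_last r)) 0 k - h (zigzag_last r) 0 k = - (2 ^+ r / 2 ^+ k.+1).
Proof.
rewrite !mxE !zigzagE flips_last //= prednK ?expn_gt0 // modnn add0n.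
rewrite divn_small ?ltn_exp2l // sub0r; congr (- _).
rewrite -[LHS]/((2 ^ (r - k.+1))%:R) natrX.
apply: canRL (mulfK _) _; first by rewrite expf_neq0 // pnatr_eq0.
by rewrite -exprD subnK.
Qed.

End Code.

(** * The embedding of the annulus *)

Theorem proposition5 (R : realType) (r : nat) (r_gt0 : (0 < r)%N)
    (lam : 'rV[R]_(2 * 2 ^ r)) (z : 'rV[R]_r) :
  let d := (2 ^ r)%N in
  let h : 'I_d -> 'rV[R]_r := @zz_code R r in
  let w (i : 'I_d) : R := lam 0 (vtx_odd i) + lam 0 (vtx_even i) in
  let g (u : 'rV[R]_r) (k l : 'I_r) : R :=
    u 0 k / 2 ^+ l.+1 - u 0 l / 2 ^+ k.+1 in
  embedding (@annulus d) h (lam, z) <->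
  [/\ forall k : 'I_r,
        \sum_(i < d) Num.min (h i 0 k) (h (ordS i) 0 k) * w i <= z 0 k,
      forall k : 'I_r,
        z 0 k <= \sum_(i < d) Num.max (h i 0 k) (h (ordS i) 0 k) * w i,
      forall k l : 'I_r, k != l ->
        \sum_(i < d) Num.min (g (h i) k l) (g (h (ordS i)) k l) * w i
          <= g z k l,
      forall k l : 'I_r, k != l ->
        g z k l
          <= \sum_(i < d) Num.max (g (h i) k l) (g (h (ordS i)) k l) * w i
    & simplex lam].
Proof.
move=> d h w g; rewrite annulus_embeddingP -/w.
split=> [[lam_simplex [y y_w zE]] | [zlo zhi glo _ lam_simplex]].
  have zkE k : z 0 k =
      \sum_i (w i * h i 0 k + y i * (h (ordS i) 0 k - h i 0 k)).
    by rewrite zE summxE; apply: eq_bigr => i _; rewrite !mxE.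
  have gzE k l : g z k l =
      \sum_i (w i * g (h i) k l + y i * (g (h (ordS i)) k l - g (h i) k l)).
    rewrite /g !zkE !mulr_suml -sumrB.
    by apply: eq_bigr => i _; ring.
  have bnd a b := andP (@sum_segment_bounds R _ a b w y y_w).
  split=> // [k|k|k l _|k l _]; rewrite ?zkE ?gzE.
  - exact: (bnd _ _).1.
  - exact: (bnd _ _).2.
  - exact: (bnd _ _).1.
  - exact: (bnd _ _).2.
split=> //; pose last : 'I_d := zigzag_last r.
pose v (k : 'I_r) : R := 2 ^+ r / 2 ^+ k.+1.
have gE (u : 'rV[R]_r) k l : u 0 k * v l - u 0 l * v k = 2 ^+ r * g u k l.
  by rewrite /g /v; ring.
have /fin_all_exists[kap kapE] (i : 'I_d) : exists k0 : 'I_r, i != last ->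
    forall k, h (ordS i) 0 k - h i 0 k = (k0 == k)%:R.
  have [_|i_last] := eqVneq i last; first by exists (Ordinal r_gt0).
  by have [k0 stepE] := zz_code_step R i_last; exists k0.
have p_ge0 : 0 <= 2 ^+ r :> R by rewrite exprn_ge0.
apply: (unit_segments_and_one (i0 := last) (kap := kap) (v := v)) => //.
- by have [lam_ge0 _] := lam_simplex => i; rewrite addr_ge0.
- by move=> k; rewrite divr_gt0 ?exprn_gt0.
- exact: zz_code_wrap.
(* The forms of the two statements differ by the factor 2^r in v. *)
move=> k l kl; rewrite gE; apply: le_trans (ler_wpM2l p_ge0 (glo k l kl)).
rewrite mulr_sumr; apply: ler_sum => i _.
by rewrite !gE -minr_pMr // mulrA.
Qed.
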